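(* Let $0<\beta<1$ and $r<0$. Let $u$ be the solution of the Caputo fractional initial value problem $$D^\beta_t u-ru=0,\quad t>0,\qquad u(0)=1,$$ namely $u(t)=E_\beta(rt^\beta)$. Then $$\beta=-\lim_{t\to\infty}\frac{t\,u'(t)}{u(t)}.$$
   Context: For $0<\beta<1$, the Caputo fractional derivative (lower terminal $0$) is $(D^\beta_t f)(t)=\frac{1}{\Gamma(1-\beta)}\int_0^t (t-\tau)^{-\beta}f'(\tau)\,d\tau$, $t>0$. The Mittag-Leffler function is $E_\alpha(z)=\sum_{k\ge0}\frac{z^k}{\Gamma(k\alpha+1)}$. *)

(* Defs.v *)
From Stdlib Require Import Arith Reals Lra Classical ClassicalEpsilon.
Open Scope R_scope.

(* Limit of a real sequence (chosen by classical description; meaningful when it converges). *)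
Definition seq_lim (u : nat -> R) : R :=
  epsilon (inhabits 0) (fun l => Un_cv u l).

(* Sum of a real series (meaningful when it converges). *)
Definition series_sum (a : nat -> R) : R :=
  epsilon (inhabits 0) (fun l => infinite_sum a l).

(* Euler's Gamma function on x > 0, via the Gauss product formula
   Gamma x = lim_n  n! n^x / (x (x+1) ... (x+n)). *)
Definition Gamma (x : R) : R :=
  seq_lim (fun n => INR (fact n) * Rpower (INR n) x
                    / prod_f_R0 (fun k => x + INR k) n).

Definition mittag_leffler (alpha z : R) : R :=
  series_sum (fun k => z ^ k / Gamma (INR k * alpha + 1)).

(* Main.v *)
Require Import Defs.
From Stdlib Require Import Reals Lra Lia Factorial ClassicalEpsilon.
From Coquelicot Require Import Coquelicot.
Open Scope R_scope.

(* Write E_c(z) = sum_k z^k / Gamma(k beta + c), so that u(t) = E_1(r t^beta).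

   Positivity.  Gauss' quotients q_n(x) = x (x+1) ... (x+n) / (n! n^x) decrease to
   1 / Gamma(x).  If f(s) = s^(-c) sum_k a_k s^(-k beta) for s > 1, the series
   sum_k a_k q_n(k beta + c) x^k is a positive multiple of (-1)^(n+1) f^(n+1)(s) at
   s = n x^(-1/beta) (Post-Widder inversion of the Laplace transform).  Hence if f
   extends to a completely monotone function on (0, oo), dominated convergence gives
   sum_k a_k x^k / Gamma(k beta + c) >= 0.  This yields E_c(-x) >= 0 for c >= beta,
   u >= 0, u' <= 0 and u'' >= 0.

   Asymptotics.  Since -x E_(c+beta)(-x) = E_c(-x) - 1 / Gamma(c), positivity for
   c = 3 - 2 beta and c = 3 - beta gives x E_3(-x) -> 1 / Gamma(3 - beta), which says
   that the second primitive t^2 E_3(r t^beta) of u is asymptotic to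
   A t^(2 - beta) with A > 0.  Three applications of the monotone density theorem
   differentiate this equivalence: u ~ B t^(-beta) and u' ~ -beta B t^(-beta-1)
   with B = (1 - beta) (2 - beta) A. *)

(** * The reciprocal Gamma function *)

Fixpoint rising (m : nat) (x : R) : R :=
  match m with
  | O => 1
  | S m => rising m x * (x + INR m)
  end.

Lemma rising_S_l (m : nat) (x : R) : rising (S m) x = x * rising m (x + 1).
Proof.
  induction m as [|m IH].
  - simpl; ring.
  - change (rising (S (S m)) x) with (rising (S m) x * (x + INR (S m))).
    rewrite IH, S_INR; simpl; ring.
Qed.

Lemma rising_prod (n : nat) (x : R) :
  prod_f_R0 (fun k => x + INR k) n = rising (S n) x.
Proof.
  induction n as [|n IH].
  - simpl; ring.
  - change (prod_f_R0 (fun k => x + INR k) n * (x + INR (S n)) = rising (S (S n)) x).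
    rewrite IH; reflexivity.
Qed.

Lemma rising_ge0 (m : nat) (x : R) : 0 <= x -> 0 <= rising m x.
Proof.
  intros Hx; induction m as [|m IH]; simpl; [lra|].
  apply Rmult_le_pos; [exact IH|].
  pose proof (pos_INR m); lra.
Qed.

Lemma rising_gt0 (m : nat) (x : R) : 0 < x -> 0 < rising m x.
Proof.
  intros Hx; induction m as [|m IH]; simpl; [lra|].
  apply Rmult_lt_0_compat; [exact IH|].
  pose proof (pos_INR m); lra.
Qed.

Lemma Rpower_gt0 (x y : R) : 0 < Rpower x y.
Proof. apply exp_pos. Qed.

(* The index is shifted by one, so that the base of the power is never [0]. *)
Definition gauss_quot (n : nat) (x : R) : R :=
  rising (S (S n)) x / (INR (fact (S n)) * Rpower (INR (S n)) x).

Lemma gauss_den_gt0 (n : nat) (x : R) :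
  0 < INR (fact (S n)) * Rpower (INR (S n)) x.
Proof. apply Rmult_lt_0_compat; [apply INR_fact_lt_0 | apply Rpower_gt0]. Qed.

Lemma gauss_quot_ge0 (n : nat) (x : R) : 0 <= x -> 0 <= gauss_quot n x.
Proof.
  intros Hx; apply Rmult_le_pos; [now apply rising_ge0|].
  apply Rlt_le, Rinv_0_lt_compat, gauss_den_gt0.
Qed.

Lemma gauss_quot_gt0 (n : nat) (x : R) : 0 < x -> 0 < gauss_quot n x.
Proof.
  intros Hx; apply Rmult_lt_0_compat; [now apply rising_gt0|].
  apply Rinv_0_lt_compat, gauss_den_gt0.
Qed.

(** With the quotient of powers written as an exponential, monotonicity in [n] becomes a comparison
    of [1 + x / (n + 2)] with an exponential. *)
Lemma gauss_quot_step (n : nat) (x : R) :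
  gauss_quot (S n) x
  = gauss_quot n x * ((1 + x / INR (S (S n)))
                      / exp (x * (ln (INR (S (S n))) - ln (INR (S n))))).
Proof.
  unfold gauss_quot.
  change (rising (S (S (S n))) x) with (rising (S (S n)) x * (x + INR (S (S n)))).
  rewrite (fact_simpl (S n)), mult_INR.
  unfold Rpower. rewrite Rmult_minus_distr_l.
  unfold Rminus; rewrite exp_plus, exp_Ropp.
  assert (INR (S (S n)) <> 0) by (apply not_0_INR; lia).
  pose proof (INR_fact_neq_0 (S n)).
  pose proof (exp_pos (x * ln (INR (S n)))).
  pose proof (exp_pos (x * ln (INR (S (S n))))).
  field; repeat split; lra.
Qed.

(** Logarithm of [1 - y <= exp (- y)] at [y = 1 / (n + 2)], where [1 - y = (n + 1) / (n + 2)]. *)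
Lemma ln_succ_diff_ge (n : nat) : / INR (S (S n)) <= ln (INR (S (S n))) - ln (INR (S n)).
Proof.
  assert (H1 : 0 < INR (S n)) by (apply lt_0_INR; lia).
  assert (H2 : INR (S (S n)) = INR (S n) + 1) by (rewrite S_INR; reflexivity).
  set (N := INR (S n)) in *. rewrite H2.
  pose proof (exp_ineq1_le (- / (N + 1))) as H.
  apply ln_le in H.
  - rewrite ln_exp in H.
    replace (1 + - / (N + 1)) with (N * / (N + 1)) in H by (field; lra).
    rewrite ln_mult, ln_Rinv in H; try lra.
    apply Rinv_0_lt_compat; lra.
  - replace (1 + - / (N + 1)) with (N / (N + 1)) by (field; lra).
    apply Rdiv_lt_0_compat; lra.
Qed.

Lemma gauss_quot_decr (n : nat) (x : R) :
  0 <= x -> gauss_quot (S n) x <= gauss_quot n x.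
Proof.
  intros Hx; rewrite gauss_quot_step.
  rewrite <- (Rmult_1_r (gauss_quot n x)) at 2.
  apply Rmult_le_compat_l; [now apply gauss_quot_ge0|].
  apply Rle_div_l; [apply exp_pos|]. rewrite Rmult_1_l.
  eapply Rle_trans; [|apply exp_ineq1_le].
  apply Rplus_le_compat_l, Rmult_le_compat_l; [exact Hx|apply ln_succ_diff_ge].
Qed.

Lemma gauss_quot_antitone (n m : nat) (x : R) :
  0 <= x -> (n <= m)%nat -> gauss_quot m x <= gauss_quot n x.
Proof.
  intros Hx Hnm; induction Hnm as [|m _ IH]; [lra|].
  eapply Rle_trans; [now apply gauss_quot_decr|exact IH].
Qed.

(* Unlike [Gamma], this is meaningful at [0], with value [0]. *)
Definition rgamma (x : R) : R := Lim_seq (fun n => gauss_quot n x).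

Lemma is_lim_seq_rgamma (x : R) :
  0 <= x -> is_lim_seq (fun n => gauss_quot n x) (rgamma x).
Proof.
  intros Hx; apply Lim_seq_correct', ex_finite_lim_seq_decr with (M := 0).
  - intros n; now apply gauss_quot_decr.
  - intros n; now apply gauss_quot_ge0.
Qed.

Lemma rgamma_ge0 (x : R) : 0 <= x -> 0 <= rgamma x.
Proof.
  intros Hx.
  apply (is_lim_seq_le (fun _ => 0) (fun n => gauss_quot n x) 0 (rgamma x)).
  - intros n; now apply gauss_quot_ge0.
  - apply is_lim_seq_const.
  - now apply is_lim_seq_rgamma.
Qed.

Lemma rgamma_le_gauss_quot (n : nat) (x : R) : 0 <= x -> rgamma x <= gauss_quot n x.
Proof.
  intros Hx.
  apply (is_lim_seq_decr_compare (fun n => gauss_quot n x)).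
  - now apply is_lim_seq_rgamma.
  - intros m; now apply gauss_quot_decr.
Qed.

Lemma is_lim_seq_inv_INR_S : is_lim_seq (fun n => / INR (S n)) 0.
Proof.
  apply (is_lim_seq_incr_1 (fun n => / INR n)).
  apply (is_lim_seq_inv _ p_infty); [apply is_lim_seq_INR | discriminate].
Qed.

(** Finite form of the functional equation of Gamma: the product gains the factor [x + n + 2], the
    power gains [n + 1], and their ratio tends to 1. *)
Lemma gauss_quot_succ_arg (n : nat) (x : R) :
  x * gauss_quot n (x + 1) = gauss_quot n x * (1 + (x + 1) * / INR (S n)).
Proof.
  unfold gauss_quot.
  replace (x * (rising (S (S n)) (x + 1)
                / (INR (fact (S n)) * Rpower (INR (S n)) (x + 1))))
    with (x * rising (S (S n)) (x + 1)
          / (INR (fact (S n)) * Rpower (INR (S n)) (x + 1)))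
    by (unfold Rdiv; ring).
  rewrite <- rising_S_l.
  change (rising (S (S (S n))) x) with (rising (S (S n)) x * (x + INR (S (S n)))).
  assert (0 < INR (S n)) by (apply lt_0_INR; lia).
  rewrite Rpower_plus, Rpower_1 by assumption.
  rewrite (S_INR (S n)).
  pose proof (INR_fact_neq_0 (S n)).
  pose proof (Rpower_gt0 (INR (S n)) x).
  field; repeat split; lra.
Qed.

Lemma rgamma_succ (x : R) : 0 <= x -> x * rgamma (x + 1) = rgamma x.
Proof.
  intros Hx.
  assert (H1 : is_lim_seq (fun n => x * gauss_quot n (x + 1)) (x * rgamma (x + 1))).
  { apply (is_lim_seq_scal_l _ x (rgamma (x + 1))), is_lim_seq_rgamma; lra. }
  assert (H2 : is_lim_seq (fun n => x * gauss_quot n (x + 1)) (rgamma x)).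
  { apply is_lim_seq_ext with (fun n => gauss_quot n x * (1 + (x + 1) * / INR (S n))).
    { intros n; symmetry; apply gauss_quot_succ_arg. }
    replace (Finite (rgamma x)) with (Finite (rgamma x * (1 + (x + 1) * 0)))
      by (f_equal; ring).
    apply is_lim_seq_mult'; [now apply is_lim_seq_rgamma|].
    apply is_lim_seq_plus'; [apply is_lim_seq_const|].
    apply (is_lim_seq_scal_l _ (x + 1) 0), is_lim_seq_inv_INR_S. }
  apply is_lim_seq_unique in H1. apply is_lim_seq_unique in H2.
  rewrite H1 in H2; now injection H2.
Qed.

(* Add the tangent inequalities at [x * z], evaluated at [0] and at [z]. *)
Lemma exp_convex_0 (x z : R) : 0 <= x <= 1 -> exp (x * z) <= 1 + x * (exp z - 1).
Proof.
  intros Hx.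
  pose proof (exp_ineq1_le ((1 - x) * z)) as H1.
  pose proof (exp_ineq1_le (- (x * z))) as H2.
  pose proof (exp_pos (x * z)) as H3.
  assert (E1 : exp z = exp (x * z) * exp ((1 - x) * z))
    by (rewrite <- exp_plus; f_equal; ring).
  assert (E2 : 1 = exp (x * z) * exp (- (x * z)))
    by (rewrite <- exp_plus, Rplus_opp_r, exp_0; reflexivity).
  apply (Rmult_le_compat_l (exp (x * z))) in H1; [|lra].
  apply (Rmult_le_compat_l (exp (x * z))) in H2; [|lra].
  rewrite <- E1 in H1. rewrite <- E2 in H2.
  apply (Rmult_le_compat_l x) in H1; [|lra].
  apply (Rmult_le_compat_l (1 - x)) in H2; [|lra].
  lra.
Qed.

(* With [S (S n)] in place of [S n] in the power, the quotients increase when [x <= 1]. *)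
Lemma rgamma_gt0_unit (x : R) : 0 < x <= 1 -> 0 < rgamma x.
Proof.
  intros Hx.
  set (d := fun n => gauss_quot n x * exp (x * (ln (INR (S n)) - ln (INR (S (S n)))))).
  assert (Hd : forall n, d n <= d (S n)).
  { intros n; unfold d; rewrite gauss_quot_step.
    set (L0 := ln (INR (S n))). set (L1 := ln (INR (S (S n)))).
    set (L2 := ln (INR (S (S (S n))))).
    assert (HN : 0 < INR (S (S n))) by (apply lt_0_INR; lia).
    replace (gauss_quot n x * ((1 + x / INR (S (S n))) / exp (x * (L1 - L0)))
             * exp (x * (L1 - L2)))
      with (gauss_quot n x * exp (x * (L0 - L1))
            * ((1 + x / INR (S (S n))) * exp (x * (L1 - L2)))).
    2:{ unfold Rdiv. rewrite <- exp_Ropp.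
        replace (- (x * (L1 - L0))) with (x * (L0 - L1)) by ring. ring. }
    rewrite <- (Rmult_1_r (_ * exp (x * (L0 - L1)))) at 1.
    apply Rmult_le_compat_l.
    { apply Rmult_le_pos; [apply gauss_quot_ge0; lra | apply Rlt_le, exp_pos]. }
    replace (exp (x * (L1 - L2))) with (/ exp (x * (L2 - L1)))
      by (rewrite <- exp_Ropp; f_equal; ring).
    apply Rle_div_r; [apply exp_pos|]. rewrite Rmult_1_l.
    (* Here [x <= 1] enters: with [z = L2 - L1], [exp z = (n + 3) / (n + 2)], and the convexity
       bound is exactly [1 + x / (n + 2)]. *)
    eapply Rle_trans; [apply exp_convex_0; lra|].
    apply Req_le. f_equal. unfold Rdiv; f_equal.
    unfold Rminus; rewrite exp_plus, exp_Ropp. unfold L1, L2.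
    assert (0 < INR (S (S (S n)))) by (apply lt_0_INR; lia).
    rewrite !exp_ln by assumption. rewrite (S_INR (S (S n))). field; lra. }
  assert (Hd0 : forall n, d O <= d n).
  { intros n; induction n; [lra|]. eapply Rle_trans; [exact IHn|apply Hd]. }
  assert (H0 : 0 < d O).
  { apply Rmult_lt_0_compat; [apply gauss_quot_gt0; lra|apply exp_pos]. }
  apply Rlt_le_trans with (1 := H0).
  apply (is_lim_seq_le (fun _ => d O) (fun n => gauss_quot n x) (d O) (rgamma x)).
  - intros n. eapply Rle_trans; [apply (Hd0 n)|]. unfold d.
    rewrite <- (Rmult_1_r (gauss_quot n x)) at 2.
    apply Rmult_le_compat_l; [apply gauss_quot_ge0; lra|].
    rewrite <- exp_0.
    apply Rnot_lt_le; intros Hc; apply exp_lt_inv in Hc.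
    assert (ln (INR (S n)) <= ln (INR (S (S n)))).
    { apply ln_le; [apply lt_0_INR; lia | apply le_INR; lia]. }
    nra.
  - apply is_lim_seq_const.
  - apply is_lim_seq_rgamma; lra.
Qed.

(** The functional equation lowers the argument by one until it lies in (0, 1]. *)
Lemma rgamma_gt0 (x : R) : 0 < x -> 0 < rgamma x.
Proof.
  intros Hx.
  destruct (nfloor_ex x) as [n Hn]; [lra|].
  assert (H : x <= INR (S n)) by (rewrite S_INR; lra).
  clear Hn. revert x Hx H. induction n as [|n IH]; intros x Hx H.
  - apply rgamma_gt0_unit; simpl in H; lra.
  - destruct (Rle_dec x 1) as [Hx1|Hx1]; [apply rgamma_gt0_unit; lra|].
    assert (Hp : 0 < rgamma (x - 1)) by (rewrite S_INR in H; apply IH; lra).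
    rewrite <- (rgamma_succ (x - 1)) in Hp by lra.
    replace (x - 1 + 1) with x in Hp by ring.
    apply (Rmult_lt_reg_l (x - 1)); lra.
Qed.

(** * Agreement with the limits, sums and Gamma defined by choice *)

Lemma seq_lim_eq (u : nat -> R) (l : R) : Un_cv u l -> seq_lim u = l.
Proof.
  intros Hl. unfold seq_lim.
  apply (UL_sequence u); [|exact Hl].
  apply (epsilon_spec (inhabits 0) (fun l => Un_cv u l)). now exists l.
Qed.

Lemma series_sum_eq (a : nat -> R) (l : R) : is_series a l -> series_sum a = l.
Proof.
  intros Hl. apply is_series_Reals in Hl. unfold series_sum.
  apply (uniqueness_sum a); [|exact Hl].
  apply (epsilon_spec (inhabits 0) (fun l => infinite_sum a l)). now exists l.
Qed.

Lemma Gamma_rgamma (x : R) : 0 < x -> Gamma x = / rgamma x.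
Proof.
  (* Once the term of index 0 is dropped, Gauss' sequence consists of the inverses of
     [gauss_quot n x]. *)
  intros Hx. apply seq_lim_eq, is_lim_seq_Reals, is_lim_seq_incr_1.
  apply is_lim_seq_ext with (fun n => / gauss_quot n x).
  - intros n. rewrite rising_prod. unfold gauss_quot, Rdiv.
    rewrite Rinv_mult, Rinv_inv. ring.
  - pose proof (rgamma_gt0 x Hx).
    apply (is_lim_seq_inv _ (rgamma x)); [apply is_lim_seq_rgamma; lra|].
    intros E; injection E; lra.
Qed.

(** * Series *)

Lemma is_lim_seq_sum_f_R0 (u : nat -> nat -> R) (l : nat -> R) (K : nat) :
  (forall k, is_lim_seq (fun n => u n k) (l k)) ->
  is_lim_seq (fun n => sum_f_R0 (u n) K) (sum_f_R0 l K).
Proof.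
  intros H; induction K as [|K IH]; simpl; [apply H|].
  now apply is_lim_seq_plus'.
Qed.

(** Tannery's theorem. The terms up to [K] contribute less than [eps / 4] for large [n]; the tail
    contributes at most twice the tail of [M], hence less than [eps / 2]. *)
Lemma Series_dominated (u : nat -> nat -> R) (l M : nat -> R) :
  ex_series M ->
  (forall n k, Rabs (u n k) <= M k) ->
  (forall k, is_lim_seq (fun n => u n k) (l k)) ->
  is_lim_seq (fun n => Series (u n)) (Series l).
Proof.
  intros HM Hu Hl.
  assert (HlM : forall k, Rabs (l k) <= M k).
  { intros k. apply (is_lim_seq_le (fun n => Rabs (u n k)) (fun _ => M k)
                       (Rabs (l k)) (M k)).
    - intros n; apply Hu.
    - apply (is_lim_seq_abs _ (l k)), Hl.
    - apply is_lim_seq_const. }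
  assert (Hex : forall v : nat -> R, (forall k, Rabs (v k) <= M k) -> ex_series v).
  { intros v Hv. now apply (@ex_series_le R_AbsRing R_CompleteNormedModule v M). }
  apply is_lim_seq_spec; intros eps.
  assert (Htail : exists K, Series (fun k => M (S K + k)%nat) < eps / 4).
  { destruct (Series_correct M HM (ball (Series M) (mkposreal (eps / 4)
      ltac:(destruct eps; simpl; lra)))) as [K HK].
    { now exists (mkposreal (eps / 4) ltac:(destruct eps; simpl; lra)). }
    exists K. specialize (HK K (le_n K)).
    rewrite (Series_incr_n M (S K)) in HK; [|lia|exact HM].
    rewrite sum_n_Reals in HK. simpl Nat.pred in HK.
    apply Rabs_lt_between in HK. unfold minus, plus, opp in HK; simpl in HK.
    change (fun k => M (S K + k)%nat) with (fun k => M (S (K + k))). lra. }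
  destruct Htail as [K HK].
  assert (Hfin : is_lim_seq (fun n => sum_f_R0 (fun k => Rabs (u n k - l k)) K) 0).
  { replace (Finite 0) with (Finite (sum_f_R0 (fun _ => 0) K)).
    - apply (is_lim_seq_sum_f_R0 (fun n k => Rabs (u n k - l k)) (fun _ => 0)).
      intros k. rewrite <- Rabs_R0. apply (is_lim_seq_abs _ 0).
      replace (Finite 0) with (Finite (l k - l k)) by (f_equal; ring).
      apply is_lim_seq_minus'; [apply Hl | apply is_lim_seq_const].
    - f_equal. rewrite sum_cte; ring. }
  apply is_lim_seq_spec in Hfin.
  destruct (Hfin (mkposreal (eps / 4) ltac:(destruct eps; simpl; lra))) as [N HN].
  exists N. intros n Hn. specialize (HN n Hn). simpl in HN.
  rewrite Rminus_0_r in HN. apply Rabs_lt_between in HN.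
  assert (Hab : ex_series (fun k => Rabs (u n k - l k))).
  { apply (@ex_series_le R_AbsRing R_CompleteNormedModule _ (fun k => 2 * M k)).
    - intros k. unfold norm; simpl. unfold abs; simpl. rewrite Rabs_Rabsolu.
      eapply Rle_trans; [apply Rabs_triang|]. rewrite Rabs_Ropp.
      pose proof (Hu n k). pose proof (HlM k). lra.
    - apply (ex_series_scal_l 2 M HM). }
  rewrite <- Series_minus by (apply Hex; auto).
  eapply Rle_lt_trans; [apply (Series_Rabs _ Hab)|].
  rewrite (Series_incr_n _ (S K)); [|lia|exact Hab]. simpl Nat.pred.
  assert (HS : Series (fun k => Rabs (u n (S K + k)%nat - l (S K + k)%nat))
               <= Series (fun k => 2 * M (S K + k)%nat)).
  { apply Series_le.
    - intros k; split; [apply Rabs_pos|].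
      eapply Rle_trans; [apply Rabs_triang|]. rewrite Rabs_Ropp.
      pose proof (Hu n (S K + k)%nat). pose proof (HlM (S K + k)%nat). lra.
    - apply (ex_series_scal_l 2 (fun k => M (S K + k)%nat)).
      now apply ex_series_incr_n. }
  rewrite Series_scal_l in HS. destruct eps as [e He]; simpl pos in *. lra.
Qed.

(** The new series is [p S + b x S'], and differentiation and multiplication by [x] keep the radius.
    Only a lower bound is stated, since scaling by 0 makes the radius infinite. *)
Lemma CV_radius_linear_mul (rho : Rbar) (p b : R) (a : nat -> R) :
  Rbar_le rho (CV_radius a) ->
  Rbar_le rho (CV_radius (fun k => (p + INR k * b) * a k)).
Proof.
  intros H.
  assert (Hs : forall c (a' : nat -> R), Rbar_le rho (CV_radius a') ->
                 Rbar_le rho (CV_radius (PS_scal c a'))).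
  { intros c a' Ha'. destruct (Req_dec c 0) as [->|Hc].
    - rewrite (CV_radius_ext _ (fun _ => 0)).
      + rewrite CV_radius_const_0. destruct rho; simpl; auto.
      + intros k. unfold PS_scal, scal; simpl; unfold mult; simpl; ring.
    - now rewrite CV_radius_scal. }
  rewrite (CV_radius_ext _ (PS_plus (PS_scal p a)
             (PS_scal b (PS_incr_1 (PS_derive a))))).
  - eapply Rbar_le_trans; [|apply CV_radius_plus].
    apply Rbar_min_case; apply Hs; [exact H|].
    now rewrite CV_radius_incr_1, CV_radius_derive.
  - intros [|k]; unfold PS_plus, PS_scal, PS_incr_1, PS_derive, plus, scal, zero;
      simpl; unfold mult; simpl; ring.
Qed.

Lemma is_derive_Rpower (p t : R) :
  0 < t -> is_derive (fun t => Rpower t p) t (p * Rpower t (p - 1)).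
Proof. intros Ht. now apply is_derive_Reals, derivable_pt_lim_power. Qed.

(** Termwise differentiation of [a_k r^k t^(p + k b)]. It serves both the Laplace side ([r = 1],
    exponent [- b]) and the solution with its primitives and derivatives. *)
Lemma is_derive_Rpower_PSeries (a : nat -> R) (p b r t : R) :
  0 < t -> Rbar_lt (Rabs (r * Rpower t b)) (CV_radius a) ->
  is_derive (fun t => Rpower t p * PSeries a (r * Rpower t b)) t
    (Rpower t (p - 1) * PSeries (fun k => (p + INR k * b) * a k) (r * Rpower t b)).
Proof.
  intros Ht Hr.
  assert (E : PSeries (fun k => (p + INR k * b) * a k) (r * Rpower t b)
              = p * PSeries a (r * Rpower t b)
                + b * ((r * Rpower t b) * PSeries (PS_derive a) (r * Rpower t b))).
  { rewrite <- PSeries_incr_1, <- !PSeries_scal, <- PSeries_plus.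
    - apply PSeries_ext.
      intros [|k]; unfold PS_plus, PS_scal, PS_incr_1, PS_derive, plus, scal, zero;
        simpl; unfold mult; simpl; ring.
    - apply ex_pseries_scal; [apply Rmult_comm|]. now apply CV_radius_inside.
    - apply ex_pseries_scal; [apply Rmult_comm|]. apply CV_radius_inside.
      now rewrite CV_radius_incr_1, CV_radius_derive. }
  rewrite E.
  replace (Rpower t (p - 1) * _)
    with (p * Rpower t (p - 1) * PSeries a (r * Rpower t b)
          + Rpower t p * ((r * (b * Rpower t (b - 1)))
                          * PSeries (PS_derive a) (r * Rpower t b))).
  - apply (is_derive_mult (fun t => Rpower t p) (fun t => PSeries a (r * Rpower t b))).
    + now apply is_derive_Rpower.
    + apply (is_derive_comp (PSeries a) (fun t => r * Rpower t b)).
      * now apply is_derive_PSeries.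
      * apply (is_derive_scal (fun t => Rpower t b)). now apply is_derive_Rpower.
    + apply Rmult_comm.
  - replace (Rpower t b) with (t * Rpower t (b - 1)).
    2:{ rewrite <- (Rpower_1 t) at 1 by assumption. rewrite <- Rpower_plus.
        f_equal; ring. }
    replace (Rpower t p) with (t * Rpower t (p - 1)).
    2:{ rewrite <- (Rpower_1 t) at 1 by assumption. rewrite <- Rpower_plus.
        f_equal; ring. }
    ring.
Qed.

(** * Complete monotonicity *)

(* Complete monotonicity on the positive half-line, up to order [n]. *)
Fixpoint cmono (n : nat) (f : R -> R) : Prop :=
  (forall s, 0 < s -> 0 <= f s) /\
  match n with
  | O => True
  | S n => exists g, (forall s, 0 < s -> is_derive f s (- g s)) /\ cmono n g
  end.

Lemma cmono_ge0 (n : nat) (f : R -> R) : cmono n f -> forall s, 0 < s -> 0 <= f s.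
Proof. destruct n; now intros [H _]. Qed.

Lemma cmono_pred (n : nat) (f : R -> R) : cmono (S n) f -> cmono n f.
Proof.
  revert f; induction n as [|n IH]; intros f [H0 [g [Hd Hg]]]; split; auto.
  exists g; auto.
Qed.

Lemma cmono_plus (n : nat) (f g : R -> R) :
  cmono n f -> cmono n g -> cmono n (fun s => f s + g s).
Proof.
  revert f g; induction n as [|n IH]; intros f g [Hf0 Hf] [Hg0 Hg]; split; auto;
    try (intros s Hs; specialize (Hf0 s Hs); specialize (Hg0 s Hs); lra).
  destruct Hf as [f' [Df Hf]], Hg as [g' [Dg Hg]].
  exists (fun s => f' s + g' s); split; [|now apply IH].
  intros s Hs. rewrite Ropp_plus_distr.
  apply (is_derive_plus f g); auto.
Qed.

Lemma cmono_scal (n : nat) (c : R) (f : R -> R) :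
  0 <= c -> cmono n f -> cmono n (fun s => c * f s).
Proof.
  intros Hc; revert f; induction n as [|n IH]; intros f [Hf0 Hf]; split; auto;
    try (intros s Hs; specialize (Hf0 s Hs); nra).
  destruct Hf as [f' [Df Hf]].
  exists (fun s => c * f' s); split; [|now apply IH].
  intros s Hs. rewrite Ropp_mult_distr_r.
  apply (is_derive_scal f); auto.
Qed.

(** Leibniz rule: if the derivatives are [- f'] and [- g'], that of the product is
    [- (f' g + f g')]. The undifferentiated factors are lowered by one order to fit the
    induction. *)
Lemma cmono_mult (n : nat) (f g : R -> R) :
  cmono n f -> cmono n g -> cmono n (fun s => f s * g s).
Proof.
  revert f g; induction n as [|n IH]; intros f g Hf Hg.
  - split; auto. intros s Hs.
    apply Rmult_le_pos; [now apply (cmono_ge0 0 f) | now apply (cmono_ge0 0 g)].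
  - pose proof (cmono_pred n f Hf) as Hf1. pose proof (cmono_pred n g Hg) as Hg1.
    destruct Hf as [Hf0 [f' [Df Hf]]], Hg as [Hg0 [g' [Dg Hg]]].
    split; [intros s Hs; apply Rmult_le_pos; auto|].
    exists (fun s => f' s * g s + f s * g' s); split.
    + intros s Hs.
      replace (- (f' s * g s + f s * g' s)) with (- f' s * g s + f s * - g' s) by ring.
      apply (is_derive_mult f g); auto. apply Rmult_comm.
    + apply cmono_plus; apply IH; auto.
Qed.

Lemma cmono_Rpower (n : nat) (p : R) : p <= 0 -> cmono n (fun s => Rpower s p).
Proof.
  revert p; induction n as [|n IH]; intros p Hp; split; auto;
    try (intros s _; apply Rlt_le, Rpower_gt0).
  exists (fun s => - p * Rpower s (p - 1)); split.
  - intros s Hs. replace (- (- p * Rpower s (p - 1))) with (p * Rpower s (p - 1)) by ring.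
    now apply is_derive_Rpower.
  - apply cmono_scal; [lra|]. apply IH; lra.
Qed.

(** For [G = 1 / (1 + s^b)], [- G' = b s^(b-1) G^2]: the power is completely monotone because
    [b <= 1], and [G] is so to the previous order by induction. *)
Lemma cmono_inv_1_Rpower (n : nat) (b : R) :
  0 <= b <= 1 -> cmono n (fun s => / (1 + Rpower s b)).
Proof.
  intros Hb.
  assert (Hp : forall s, 0 < 1 + Rpower s b)
    by (intros s; pose proof (Rpower_gt0 s b); lra).
  induction n as [|n IH]; split; auto;
    try (intros s _; apply Rlt_le, Rinv_0_lt_compat, Hp).
  exists (fun s => b * Rpower s (b - 1) * (/ (1 + Rpower s b) * / (1 + Rpower s b))).
  split.
  - intros s Hs.
    replace (- _) with (- (b * Rpower s (b - 1)) / (1 + Rpower s b) ^ 2)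
      by (pose proof (Hp s); field; lra).
    apply (is_derive_inv (fun s => 1 + Rpower s b)).
    + rewrite <- (Rplus_0_l (b * _)).
      apply (is_derive_plus (fun _ => 1) (fun s => Rpower s b)).
      * apply (@is_derive_const R_AbsRing R_NormedModule).
      * now apply is_derive_Rpower.
    + pose proof (Hp s); lra.
  - apply cmono_mult; [|now apply cmono_mult].
    apply cmono_scal; [lra|]. apply cmono_Rpower; lra.
Qed.

(** * Post-Widder inversion and positivity *)

Lemma Rpower_neg_lt1 (s b : R) : 1 < s -> 0 < b -> Rabs (1 * Rpower s (- b)) < 1.
Proof.
  intros Hs Hb. rewrite Rmult_1_l, Rabs_pos_eq by (apply Rlt_le, Rpower_gt0).
  rewrite <- (Rpower_O s) by lra. apply Rpower_lt; lra.
Qed.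

Lemma CV_radius_rising_mul (rho : Rbar) (n : nat) (b c : R) (a : nat -> R) :
  Rbar_le rho (CV_radius a) ->
  Rbar_le rho (CV_radius (fun k => a k * rising n (INR k * b + c))).
Proof.
  intros Ha; induction n as [|n IH].
  - rewrite (CV_radius_ext _ a); [exact Ha|]. intros k; simpl; ring.
  - apply (CV_radius_linear_mul rho (c + INR n) b) in IH.
    rewrite (CV_radius_ext _ (fun k => (c + INR n + INR k * b)
                                       * (a k * rising n (INR k * b + c)))); [exact IH|].
    intros k; simpl; ring.
Qed.

(** Up to the factor [s^(-c-n)], the series is [(-1)^n f^(n)(s)]. Each differentiation multiplies
    [a_k] by [-(c + k b)] and raises [c] by one, so the induction passes from [f] to [- f']. *)
Lemma cmono_rising_PSeries_ge0 (b : R) (n : nat) (a : nat -> R) (c : R) (f : R -> R) :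
  0 < b -> Rbar_le 1 (CV_radius a) -> cmono n f ->
  (forall s, 1 < s -> f s = Rpower s (- c) * PSeries a (1 * Rpower s (- b))) ->
  forall s, 1 < s ->
    0 <= PSeries (fun k => a k * rising n (INR k * b + c)) (Rpower s (- b)).
Proof.
  intros Hb. revert a c f. induction n as [|n IH]; intros a c f Ha Hf Hfa s Hs.
  - rewrite (PSeries_ext _ a) by (intros k; simpl; ring).
    pose proof (cmono_ge0 0 f Hf s ltac:(lra)) as H0.
    rewrite Hfa, Rmult_1_l in H0 by lra.
    apply (Rmult_le_reg_l (Rpower s (- c))); [apply Rpower_gt0|]. lra.
  - destruct Hf as [_ [g [Dg Hg]]].
    rewrite (PSeries_ext _ (fun k => ((c + INR k * b) * a k)
                                     * rising n (INR k * b + (c + 1)))).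
    2:{ intros k. rewrite rising_S_l. rewrite <- Rplus_assoc. ring. }
    apply (IH (fun k => (c + INR k * b) * a k) (c + 1) g); auto.
    { now apply CV_radius_linear_mul. }
    intros v Hv.
    assert (Hin : Rbar_lt (Rabs (1 * Rpower v (- b))) (CV_radius a)).
    { apply Rbar_lt_le_trans with 1; [apply Rpower_neg_lt1; lra | exact Ha]. }
    pose proof (is_derive_Rpower_PSeries a (- c) (- b) 1 v ltac:(lra) Hin) as D1.
    assert (D2 : is_derive (fun t => Rpower t (- c) * PSeries a (1 * Rpower t (- b))) v
                   (- g v)).
    { apply is_derive_ext_loc with f; [|apply Dg; lra].
      exists (mkposreal (v - 1) ltac:(lra)). intros w Hw.
      apply Hfa. apply Rabs_lt_between in Hw.
      unfold minus, plus, opp in Hw; simpl in Hw. lra. }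
    apply is_derive_unique in D1. apply is_derive_unique in D2.
    rewrite D1 in D2.
    replace (- (c + 1)) with (- c - 1) by ring.
    rewrite <- (Ropp_involutive (g v)), <- D2, Ropp_mult_distr_r, <- PSeries_opp.
    f_equal. apply PSeries_ext. intros k.
    unfold PS_opp, opp; simpl; ring.
Qed.

Lemma index_ge0 (b c : R) (k : nat) : 0 <= b -> 0 <= c -> 0 <= INR k * b + c.
Proof.
  intros Hb Hc; apply Rplus_le_le_0_compat; [|exact Hc].
  apply Rmult_le_pos; [apply pos_INR|exact Hb].
Qed.

(** Supplies the dominating series. Once [N + 1 > x^(1/b)], [y = x (N+1)^(-b)] is less than 1, and
    the general term is a constant times [|a_k| y^k] times a polynomial in [k]. *)
Lemma ex_series_gauss_quot (b c x : R) (a : nat -> R) :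
  0 < b -> 0 <= c -> 0 < x -> Rbar_le 1 (CV_radius a) ->
  exists N, x * Rpower (INR (S N)) (- b) < 1 /\
    ex_series (fun k => Rabs (a k) * gauss_quot N (INR k * b + c) * x ^ k).
Proof.
  intros Hb Hc Hx Ha.
  destruct (nfloor_ex (Rpower x (/ b))) as [N HN]; [apply Rlt_le, Rpower_gt0|].
  exists N.
  assert (HN0 : 0 < INR (S N)) by (apply lt_0_INR; lia).
  assert (Hlt : x * Rpower (INR (S N)) (- b) < 1).
  { rewrite Rpower_Ropp. apply Rlt_div_l; [apply Rpower_gt0|]. rewrite Rmult_1_l.
    replace x with (Rpower (Rpower x (/ b)) b).
    - apply Rlt_Rpower_l; [exact Hb|]. split; [apply Rpower_gt0|].
      rewrite S_INR; lra.
    - rewrite Rpower_mult, Rinv_l, Rpower_1; lra. }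
  split; [exact Hlt|].
  set (y := x * Rpower (INR (S N)) (- b)) in *.
  assert (Hy : 0 < y) by (apply Rmult_lt_0_compat; [lra|apply Rpower_gt0]).
  assert (HD : ex_series (fun k => Rabs (a k * rising (S (S N)) (INR k * b + c) * y ^ k))).
  { apply (CV_disk_inside (fun k => a k * rising (S (S N)) (INR k * b + c))).
    apply Rbar_lt_le_trans with 1; [simpl; rewrite Rabs_pos_eq; lra|].
    now apply CV_radius_rising_mul. }
  assert (HD' : ex_series (fun k => / (INR (fact (S N)) * Rpower (INR (S N)) c)
                  * Rabs (a k * rising (S (S N)) (INR k * b + c) * y ^ k)))
    by exact (ex_series_scal_l _ _ HD).
  eapply ex_series_ext; [|exact HD']. intros k; cbv beta.
  match goal with |- ?l = ?r => change (@eq R l r) end.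
  pose proof (index_ge0 b c k ltac:(lra) Hc) as Hk.
  rewrite !Rabs_mult, (Rabs_pos_eq (rising _ _)), (Rabs_pos_eq (y ^ k)).
  2:{ apply pow_le; lra. }
  2:{ now apply rising_ge0. }
  unfold gauss_quot, y. rewrite Rpow_mult_distr.
  rewrite <- (Rpower_pow k (Rpower _ _)), Rpower_mult by apply Rpower_gt0.
  rewrite Rpower_plus.
  replace (- b * INR k) with (- (INR k * b)) by ring. rewrite Rpower_Ropp.
  pose proof (INR_fact_neq_0 (S N)).
  pose proof (Rpower_gt0 (INR (S N)) c).
  pose proof (Rpower_gt0 (INR (S N)) (INR k * b)).
  field; repeat split; lra.
Qed.

(** Every [x > 0] is within the radius: since [rgamma] is below each Gauss quotient, the terms at
    [x] are dominated by a convergent series. *)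
Lemma CV_radius_rgamma (b c : R) (a : nat -> R) :
  0 < b -> 0 <= c -> Rbar_le 1 (CV_radius a) ->
  CV_radius (fun k => a k * rgamma (INR k * b + c)) = p_infty.
Proof.
  intros Hb Hc Ha.
  set (e := fun k => a k * rgamma (INR k * b + c)).
  assert (H : forall x, 0 < x -> Rbar_le x (CV_radius e)).
  { intros x Hx.
    destruct (ex_series_gauss_quot b c x a Hb Hc Hx Ha) as [N [_ HN]].
    apply Rbar_not_lt_le; intros Hlt.
    apply (CV_disk_outside e x).
    - now rewrite Rabs_pos_eq by lra.
    - apply ex_series_lim_0.
      apply (@ex_series_le R_AbsRing R_CompleteNormedModule _ _ ) with (2 := HN).
      intros k. pose proof (index_ge0 b c k ltac:(lra) Hc) as Hk.
      unfold norm; simpl; unfold abs; simpl. unfold e.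
      rewrite !Rabs_mult, (Rabs_pos_eq (rgamma _)), (Rabs_pos_eq (x ^ k)).
      + apply Rmult_le_compat_r; [apply pow_le; lra|].
        apply Rmult_le_compat_l; [apply Rabs_pos|]. now apply rgamma_le_gauss_quot.
      + apply pow_le; lra.
      + now apply rgamma_ge0. }
  destruct (CV_radius e) as [l| |] eqn:El; auto.
  - specialize (H (Rabs l + 1) ltac:(pose proof (Rabs_pos l); lra)).
    simpl in H. pose proof (Rle_abs l). lra.
  - destruct (H 1 Rlt_0_1).
Qed.

(* The Gauss quotients are the weights of the Post-Widder inversion formula: the
   series with weights [gauss_quot n] is, up to a positive factor,
   [(-1)^(n+2) f^(n+2)(s)] at the point [s] with [s^(-b) = x (n+1)^(-b)]. *)
Lemma cmono_rgamma_PSeries_ge0 (b c x : R) (a : nat -> R) (f : R -> R) :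
  0 < b -> 0 <= c -> 0 < x -> Rbar_le 1 (CV_radius a) -> (forall n, cmono n f) ->
  (forall s, 1 < s -> f s = Rpower s (- c) * PSeries a (1 * Rpower s (- b))) ->
  0 <= PSeries (fun k => a k * rgamma (INR k * b + c)) x.
Proof.
  intros Hb Hc Hx Ha Hf Hfa.
  destruct (ex_series_gauss_quot b c x a Hb Hc Hx Ha) as [N [HxN HN]].
  (* The sequence starts at [N], where domination is available; later quotients are smaller. *)
  assert (Hlim : is_lim_seq
            (fun n => Series (fun k => a k * gauss_quot (N + n) (INR k * b + c) * x ^ k))
            (Series (fun k => a k * rgamma (INR k * b + c) * x ^ k))).
  { apply Series_dominated with (1 := HN).
    - intros n k. pose proof (index_ge0 b c k ltac:(lra) Hc) as Hk.
      rewrite !Rabs_mult, (Rabs_pos_eq (gauss_quot _ _)), (Rabs_pos_eq (x ^ k)).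
      + apply Rmult_le_compat_r; [apply pow_le; lra|].
        apply Rmult_le_compat_l; [apply Rabs_pos|].
        apply gauss_quot_antitone; [exact Hk | lia].
      + apply pow_le; lra.
      + now apply gauss_quot_ge0.
    - intros k. pose proof (index_ge0 b c k ltac:(lra) Hc) as Hk.
      apply (is_lim_seq_scal_r _ (x ^ k) (a k * rgamma _)).
      apply (is_lim_seq_scal_l _ (a k) (rgamma _)).
      apply is_lim_seq_ext with (fun n => gauss_quot (n + N) (INR k * b + c)).
      { intros n; f_equal; lia. }
      apply (is_lim_seq_incr_n (fun n => gauss_quot n (INR k * b + c))).
      now apply is_lim_seq_rgamma. }
  unfold PSeries.
  eapply (is_lim_seq_le (fun _ => 0) _ 0 (Finite _)); [|apply is_lim_seq_const|exact Hlim].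
  intros n; cbv beta.
  set (m := (N + n)%nat).
  assert (Hm : 0 < INR (S m)) by (apply lt_0_INR; lia).
  set (y := x * Rpower (INR (S m)) (- b)).
  assert (Hy0 : 0 < y) by (apply Rmult_lt_0_compat; [lra|apply Rpower_gt0]).
  assert (Hy1 : y < 1).
  { eapply Rle_lt_trans; [|exact HxN]. apply Rmult_le_compat_l; [lra|].
    rewrite !Rpower_Ropp. apply Rinv_le_contravar; [apply Rpower_gt0|].
    apply Rle_Rpower_l; [lra|]. split; [apply lt_0_INR; lia|apply le_INR; lia]. }
  set (s := Rpower y (- / b)).
  assert (Hs : Rpower s (- b) = y).
  { unfold s. rewrite Rpower_mult. replace (- / b * - b) with 1 by (field; lra).
    now apply Rpower_1. }
  assert (Hs1 : 1 < s).
  { unfold s, Rpower. rewrite <- exp_0. apply exp_increasing.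
    assert (ln y < 0) by (rewrite <- ln_1; apply ln_increasing; lra).
    assert (0 < / b) by (apply Rinv_0_lt_compat; lra). nra. }
  pose proof (cmono_rising_PSeries_ge0 b (S (S m)) a c f Hb Ha (Hf _) Hfa s Hs1) as HP.
  (* Now [gauss_quot m (k b + c) x^k] is [rising (m+2) (k b + c) y^k] divided by [(m+1)! (m+1)^c],
     which does not depend on [k]. *)
  rewrite Hs in HP.
  rewrite (Series_ext _ (fun k => / (INR (fact (S m)) * Rpower (INR (S m)) c)
             * (a k * rising (S (S m)) (INR k * b + c) * y ^ k))).
  - rewrite Series_scal_l. apply Rmult_le_pos; [|exact HP].
    apply Rlt_le, Rinv_0_lt_compat, gauss_den_gt0.
  - intros k. unfold gauss_quot, y. rewrite Rpow_mult_distr.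
    rewrite <- (Rpower_pow k (Rpower _ _)), Rpower_mult by apply Rpower_gt0.
    rewrite Rpower_plus.
    replace (- b * INR k) with (- (INR k * b)) by ring. rewrite Rpower_Ropp.
    pose proof (INR_fact_neq_0 (S m)).
    pose proof (Rpower_gt0 (INR (S m)) c).
    pose proof (Rpower_gt0 (INR (S m)) (INR k * b)).
    field; repeat split; lra.
Qed.

(** * Monotone density *)

Lemma is_lim_dilate (v : R -> R) (l : R) (A : Rbar) :
  0 < l -> is_lim v p_infty A -> is_lim (fun t => v (l * t)) p_infty A.
Proof.
  intros Hl Hv.
  apply is_lim_comp with (1 := Hv).
  - apply is_lim_spec. intros M. exists (M / l). intros t Ht.
    apply Rlt_div_l in Ht; [lra | exact Hl].
  - exists 0; intros t _; discriminate.
Qed.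

(* The increment of [H] over [t, (1 + d) t] brackets [d * t * h t]; let
   [t] tend to infinity, then [d] to [0]. *)
Lemma monotone_density_incr (H h : R -> R) (p A : R) :
  (forall t, 0 < t -> is_derive H t (h t)) ->
  (forall s t, 0 < s <= t -> h s <= h t) ->
  is_lim (fun t => H t * Rpower t (- p)) p_infty A ->
  is_lim (fun t => h t * Rpower t (1 - p)) p_infty (p * A).
Proof.
  intros DH Mh Hlim.
  set (v := fun t => H t * Rpower t (- p)) in *.
  (* For [t > 0] and [d > -1], [Q d t = (H ((1+d) t) - H t) t^(-p) / d]; written through [v], its
     limit in [t] is immediate. Positive [d] bounds [h] from above, negative [d] from below. *)
  set (Q := fun d t => (Rpower (1 + d) p * v ((1 + d) * t) - v t) / d).
  assert (HQlim : forall d, -1 < d -> is_lim (Q d) p_infty ((Rpower (1 + d) p * A - A) / d)).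
  { intros d Hd.
    apply (is_lim_scal_r _ (/ d) p_infty (Rpower (1 + d) p * A - A)).
    apply is_lim_minus'; [|exact Hlim].
    apply (is_lim_scal_l _ (Rpower (1 + d) p) p_infty A).
    apply is_lim_dilate; [lra|exact Hlim]. }
  assert (HvQ : forall d t, -1 < d -> 0 < t ->
            Rpower (1 + d) p * v ((1 + d) * t) = H ((1 + d) * t) * Rpower t (- p)).
  { intros d t Hd Ht. unfold v.
    rewrite <- Rpower_mult_distr, (Rpower_Ropp (1 + d)) by lra.
    pose proof (Rpower_gt0 (1 + d) p). field; lra. }
  assert (Hh : forall t, 0 < t -> h t * Rpower t (1 - p) = h t * t * Rpower t (- p)).
  { intros t Ht. unfold Rminus. rewrite Rpower_plus, Rpower_1 by exact Ht. ring. }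
  assert (Hup : forall d t, 0 < d -> 0 < t -> h t * Rpower t (1 - p) <= Q d t).
  { intros d t Hd Ht. unfold Q. rewrite HvQ, Hh by lra. unfold v.
    destruct (MVT_cor2 H h t ((1 + d) * t)) as [c [Hc1 Hc2]]; [nra| |].
    { intros c Hc. apply is_derive_Reals, DH; lra. }
    apply (proj1 (Rle_div_r _ _ d Hd)).
    pose proof (Mh t c ltac:(lra)). pose proof (Rpower_gt0 t (- p)).
    replace (H ((1 + d) * t) * Rpower t (- p) - H t * Rpower t (- p))
      with (h c * (d * t) * Rpower t (- p)).
    2:{ replace (h c * (d * t)) with (H ((1 + d) * t) - H t) by (rewrite Hc1; ring). ring. }
    replace (h t * t * Rpower t (- p) * d) with (h t * (d * t) * Rpower t (- p)) by ring.
    apply Rmult_le_compat_r; [lra|]. apply Rmult_le_compat_r; [nra|lra]. }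
  assert (Hlo : forall d t, 0 < d < 1 -> 0 < t -> Q (- d) t <= h t * Rpower t (1 - p)).
  { intros d t Hd Ht. unfold Q. rewrite HvQ, Hh by lra. unfold v.
    destruct (MVT_cor2 H h ((1 + - d) * t) t) as [c [Hc1 Hc2]]; [nra| |].
    { intros c Hc. apply is_derive_Reals, DH. nra. }
    replace ((H ((1 + - d) * t) * Rpower t (- p) - H t * Rpower t (- p)) / - d)
      with (h c * t * Rpower t (- p)).
    2:{ replace (H ((1 + - d) * t)) with (H t - h c * (d * t))
          by (replace (h c * (d * t)) with (H t - H ((1 + - d) * t))
                by (rewrite Hc1; ring); ring).
        field; lra. }
    pose proof (Mh c t ltac:(nra)). pose proof (Rpower_gt0 t (- p)).
    apply Rmult_le_compat_r; [lra|]. apply Rmult_le_compat_r; [lra|lra]. }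
  apply is_lim_spec. intros [eps Heps]. simpl pos.
  (* The tolerance for the slope of [d -> (1+d)^p] at 0 is divided by [|A| + 1], which is nonzero
     even when [A = 0]. *)
  assert (HA : 0 < 2 * (Rabs A + 1)) by (pose proof (Rabs_pos A); lra).
  destruct (derivable_pt_lim_power 1 p Rlt_0_1 (eps / (2 * (Rabs A + 1)))) as [delta Hdelta].
  { now apply Rdiv_lt_0_compat. }
  assert (Hslope : forall d, d <> 0 -> Rabs d < delta ->
            Rabs ((Rpower (1 + d) p * A - A) / d - p * A) < eps / 2).
  { intros d Hd0 Hd. specialize (Hdelta d Hd0 Hd).
    assert (E1 : forall q, Rpower 1 q = 1).
    { intros q. unfold Rpower. rewrite ln_1, Rmult_0_r. apply exp_0. }
    rewrite !E1, Rmult_1_r in Hdelta.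
    replace ((Rpower (1 + d) p * A - A) / d - p * A)
      with (((Rpower (1 + d) p - 1) / d - p) * A) by (field; exact Hd0).
    rewrite Rabs_mult.
    apply Rle_lt_trans with (eps / (2 * (Rabs A + 1)) * Rabs A).
    - apply Rmult_le_compat_r; [apply Rabs_pos|lra].
    - replace (eps / 2) with (eps / (2 * (Rabs A + 1)) * (Rabs A + 1)) by (field; lra).
      apply Rmult_lt_compat_l; [now apply Rdiv_lt_0_compat|lra]. }
  destruct delta as [delta Hdpos]; simpl pos in Hslope. clear Hdelta.
  set (d := Rmin delta 1 / 2).
  assert (Hd : 0 < d < 1 /\ d < delta).
  { unfold d. pose proof (Rmin_l delta 1). pose proof (Rmin_r delta 1).
    pose proof (Rmin_glb_lt delta 1 0 Hdpos Rlt_0_1). lra. }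
  assert (S1 := Hslope d ltac:(lra) ltac:(rewrite Rabs_pos_eq; lra)).
  assert (S2 := Hslope (- d) ltac:(lra) ltac:(rewrite Rabs_Ropp, Rabs_pos_eq; lra)).
  assert (L1 := HQlim d ltac:(lra)). assert (L2 := HQlim (- d) ltac:(lra)).
  apply is_lim_spec in L1. apply is_lim_spec in L2.
  assert (He2 : 0 < eps / 2) by lra.
  destruct (L1 (mkposreal _ He2)) as [M1 HM1].
  destruct (L2 (mkposreal _ He2)) as [M2 HM2].
  exists (Rmax 0 (Rmax M1 M2)). intros t Ht.
  assert (H3 := Rmax_Rlt 0 (Rmax M1 M2) t). apply H3 in Ht. destruct Ht as [Ht0 Ht].
  apply Rmax_Rlt in Ht. destruct Ht as [Ht1 Ht2].
  specialize (HM1 t Ht1). specialize (HM2 t Ht2). simpl pos in HM1, HM2.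
  pose proof (Hup d t ltac:(lra) Ht0). pose proof (Hlo d t ltac:(lra) Ht0).
  apply Rabs_lt_between in S1. apply Rabs_lt_between in S2.
  apply Rabs_lt_between in HM1. apply Rabs_lt_between in HM2.
  apply Rabs_lt_between. lra.
Qed.

Lemma monotone_density_decr (H h : R -> R) (p A : R) :
  (forall t, 0 < t -> is_derive H t (h t)) ->
  (forall s t, 0 < s <= t -> h t <= h s) ->
  is_lim (fun t => H t * Rpower t (- p)) p_infty A ->
  is_lim (fun t => h t * Rpower t (1 - p)) p_infty (p * A).
Proof.
  intros DH Mh Hlim.
  replace (Finite (p * A)) with (Rbar_opp (p * - A)) by (simpl; f_equal; ring).
  apply is_lim_ext with (fun t => - (- h t * Rpower t (1 - p))).
  { intros t; ring. }
  apply is_lim_opp.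
  apply (monotone_density_incr (fun t => - H t) (fun t => - h t)).
  - intros t Ht. apply (is_derive_opp H), DH, Ht.
  - intros s t Hst. specialize (Mh s t Hst). lra.
  - apply is_lim_ext with (fun t => - (H t * Rpower t (- p))).
    { intros t; ring. }
    now apply (is_lim_opp _ p_infty A).
Qed.

Lemma derive_ge0_incr (f f' : R -> R) :
  (forall t, 0 < t -> is_derive f t (f' t)) -> (forall t, 0 < t -> 0 <= f' t) ->
  forall s t, 0 < s <= t -> f s <= f t.
Proof.
  intros Df Pf s t [Hs [Hst|<-]]; [|lra].
  destruct (MVT_cor2 f f' s t Hst) as [c [Hc1 Hc2]].
  { intros c Hc. apply is_derive_Reals, Df; lra. }
  pose proof (Pf c ltac:(lra)). nra.
Qed.

Lemma is_lim_Rpower_neg (b : R) : 0 < b -> is_lim (fun t => Rpower t (- b)) p_infty 0.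
Proof.
  intros Hb. apply is_lim_spec. intros [eps Heps]. simpl pos.
  exists (Rpower eps (- / b)). intros t Ht.
  rewrite Rminus_0_r, Rabs_pos_eq by apply Rlt_le, Rpower_gt0.
  replace eps with (/ Rpower (Rpower eps (- / b)) b).
  - rewrite Rpower_Ropp. apply Rinv_lt_contravar.
    + apply Rmult_lt_0_compat; apply Rpower_gt0.
    + apply Rlt_Rpower_l; [exact Hb|]. split; [apply Rpower_gt0 | exact Ht].
  - rewrite Rpower_mult, <- Rpower_Ropp.
    replace (- (- / b * b)) with 1 by (field; lra). now apply Rpower_1.
Qed.

(** * The Mittag-Leffler function *)

(* The two-parameter Mittag-Leffler function [E_{b,c}(z)]. *)
Definition mlf (b c z : R) : R := PSeries (fun k => rgamma (INR k * b + c)) z.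

Lemma CV_radius_const_1 : Rbar_le 1 (CV_radius (fun _ => 1)).
Proof.
  rewrite (CV_radius_finite_DAlembert _ 1).
  - rewrite Rinv_1. apply Rbar_le_refl.
  - intros; lra.
  - lra.
  - apply is_lim_seq_ext with (fun _ => 1); [|apply is_lim_seq_const].
    intros n. unfold Rdiv. rewrite Rinv_1, Rmult_1_l, Rabs_R1. reflexivity.
Qed.

Lemma CV_radius_alternating : Rbar_le 1 (CV_radius (fun k => (-1) ^ k)).
Proof.
  rewrite (CV_radius_finite_DAlembert _ 1).
  - rewrite Rinv_1. apply Rbar_le_refl.
  - intros n. apply pow_nonzero; lra.
  - lra.
  - apply is_lim_seq_ext with (fun _ => 1); [|apply is_lim_seq_const].
    intros n. replace ((-1) ^ S n / (-1) ^ n) with (-1).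
    + now rewrite Rabs_left by lra; ring.
    + simpl. field. apply pow_nonzero; lra.
Qed.

Lemma CV_radius_mlf (b c : R) :
  0 < b -> 0 <= c -> CV_radius (fun k => rgamma (INR k * b + c)) = p_infty.
Proof.
  intros Hb Hc.
  rewrite <- (CV_radius_rgamma b c (fun _ => 1) Hb Hc CV_radius_const_1).
  apply CV_radius_ext. intros k; ring.
Qed.

(** Removing the constant term shifts the index by one, hence [c] by [b]. At negative [z] this turns
    positivity of [mlf b c] into an upper bound on [mlf b (c + b)]. *)
Lemma mlf_shift (b c z : R) :
  0 < b -> 0 <= c -> z * mlf b (c + b) z = mlf b c z - rgamma c.
Proof.
  intros Hb Hc. unfold mlf.
  rewrite (PSeries_decr_1 (fun k => rgamma (INR k * b + c))).
  - simpl (INR 0). rewrite Rmult_0_l, Rplus_0_l.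
    rewrite (PSeries_ext (PS_decr_1 _) (fun k => rgamma (INR k * b + (c + b)))); [ring|].
    intros k. unfold PS_decr_1. rewrite S_INR. f_equal; ring.
  - apply CV_radius_inside. now rewrite CV_radius_mlf.
Qed.

Lemma PSeries_alternating (y : R) :
  Rabs y < 1 -> PSeries (fun k => (-1) ^ k) y = / (1 + y).
Proof.
  intros Hy. unfold PSeries.
  rewrite (Series_ext _ (fun k => (- y) ^ k)).
  - rewrite Series_geom by (now rewrite Rabs_Ropp). f_equal; ring.
  - intros k. rewrite <- Rpow_mult_distr. f_equal; ring.
Qed.

Lemma PSeries_alternating_opp (a : nat -> R) (x : R) :
  PSeries (fun k => (-1) ^ k * a k) x = PSeries a (- x).
Proof.
  apply Series_ext. intros k.
  replace (- x) with (-1 * x) by ring. rewrite Rpow_mult_distr. ring.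
Qed.

(** The function [s^(b-c) / (1 + s^b)], Laplace transform of [t^(c-1) E_{b,c}(-t^b)], is a product
    of completely monotone factors; for [s > 1] a geometric series expands it. *)
Lemma mlf_ge0 (b c x : R) : 0 < b <= 1 -> b <= c -> 0 < x -> 0 <= mlf b c (- x).
Proof.
  intros Hb Hc Hx. unfold mlf. rewrite <- PSeries_alternating_opp.
  apply cmono_rgamma_PSeries_ge0 with (fun s => Rpower s (b - c) * / (1 + Rpower s b));
    try lra.
  - apply CV_radius_alternating.
  - intros n. apply cmono_mult; [apply cmono_Rpower; lra|apply cmono_inv_1_Rpower; lra].
  - intros s Hs. rewrite PSeries_alternating by (apply Rpower_neg_lt1; lra).
    unfold Rminus. rewrite Rpower_plus, !Rpower_Ropp.
    pose proof (Rpower_gt0 s b). pose proof (Rpower_gt0 s c).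
    field; repeat split; lra.
Qed.

Lemma rgamma_0 : rgamma 0 = 0.
Proof. rewrite <- rgamma_succ by lra. ring. Qed.

(** Starting the geometric series at [k = 1] multiplies [1 / (1 + s^(-b))] by [s^(-b)]. *)
Lemma PSeries_incr_alternating (b s : R) :
  0 < b -> 1 < s ->
  PSeries (PS_incr_1 (fun k => (-1) ^ k)) (1 * Rpower s (- b)) = / (1 + Rpower s b).
Proof.
  intros Hb Hs. rewrite PSeries_incr_1, PSeries_alternating by (apply Rpower_neg_lt1; lra).
  rewrite Rpower_Ropp. pose proof (Rpower_gt0 s b). field; lra.
Qed.

Lemma CV_radius_incr_alternating : Rbar_le 1 (CV_radius (PS_incr_1 (fun k => (-1) ^ k))).
Proof. rewrite CV_radius_incr_1. apply CV_radius_alternating. Qed.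

(** For [u(t) = E_b(-t^b)], [1 / (1 + s^b)] is the Laplace transform of [- u']. Its expansion has no
    constant term, in accordance with [rgamma 0 = 0]. *)
Lemma mlf_0_le0 (b x : R) : 0 < b <= 1 -> 0 < x -> mlf b 0 (- x) <= 0.
Proof.
  intros Hb Hx.
  assert (H : 0 <= PSeries (fun k => PS_incr_1 (fun k => (-1) ^ k) k
                                     * rgamma (INR k * b + 0)) x).
  { apply cmono_rgamma_PSeries_ge0 with (fun s => / (1 + Rpower s b)); try lra.
    - apply CV_radius_incr_alternating.
    - intros n. apply cmono_inv_1_Rpower; lra.
    - intros s Hs. rewrite PSeries_incr_alternating, Ropp_0, Rpower_O by lra. ring. }
  rewrite (PSeries_ext _ (PS_opp (fun k => (-1) ^ k * rgamma (INR k * b + 0)))) in H.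
  - rewrite PSeries_opp, PSeries_alternating_opp in H. unfold mlf. lra.
  - intros [|k]; unfold PS_opp, PS_incr_1, opp, zero; simpl.
    + replace (0 * b + 0) with 0 by ring. rewrite rgamma_0. ring.
    + ring.
Qed.

(* The completely monotone function is the derivative of [s / (1 + s^b)]: this is
   the Laplace transform of [t u''(t)] for [u(t) = E_b(-t^b)]. *)
Lemma mlf_second_derivative_ge0 (b x : R) :
  0 < b <= 1 -> 0 < x ->
  0 <= PSeries (fun k => (-1 + INR k * b) * rgamma (INR k * b + 0)) (- x).
Proof.
  intros Hb Hx.
  set (a := PS_incr_1 (fun k => (-1) ^ k)).
  set (G := fun s => / (1 + Rpower s b)).
  assert (HG : forall s, 1 < s -> PSeries a (1 * Rpower s (- b)) = G s)
    by (intros s Hs; apply PSeries_incr_alternating; lra).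
  assert (H : 0 <= PSeries (fun k => (1 + INR k * - b) * a k * rgamma (INR k * b + 0)) x).
  (* Since [s^b G = 1 - G], the derivative of [s G] is [(1 - b) G + b G^2], visibly completely
     monotone. Differentiating [s] times the series of [G] produces the factors [1 - k b]. *)
  { apply cmono_rgamma_PSeries_ge0 with (fun s => (1 - b) * G s + b * (G s * G s)); try lra.
    - apply CV_radius_linear_mul, CV_radius_incr_alternating.
    - intros n. apply cmono_plus; apply cmono_scal; try lra.
      + apply cmono_inv_1_Rpower; lra.
      + apply cmono_mult; apply cmono_inv_1_Rpower; lra.
    - intros s Hs.
      assert (Hin : Rbar_lt (Rabs (1 * Rpower s (- b))) (CV_radius a)).
      { apply Rbar_lt_le_trans with 1;
          [apply Rpower_neg_lt1; lra | apply CV_radius_incr_alternating]. }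
      pose proof (is_derive_Rpower_PSeries a 1 (- b) 1 s ltac:(lra) Hin) as D1.
      assert (D2 : is_derive (fun t => Rpower t 1 * PSeries a (1 * Rpower t (- b))) s
                     ((1 - b) * G s + b * (G s * G s))).
      { apply is_derive_ext_loc with (fun t => t / (1 + Rpower t b)).
        - exists (mkposreal (s - 1) ltac:(lra)). intros w Hw.
          apply Rabs_lt_between in Hw. unfold minus, plus, opp in Hw; simpl in Hw.
          rewrite HG, Rpower_1 by lra. reflexivity.
        - pose proof (Rpower_gt0 s b) as Hsb.
          replace ((1 - b) * G s + b * (G s * G s))
            with ((1 * (1 + Rpower s b) - s * (0 + b * Rpower s (b - 1)))
                  / (1 + Rpower s b) ^ 2).
          + apply (is_derive_div (fun t => t) (fun t => 1 + Rpower t b)).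
            * apply (@is_derive_id R_AbsRing).
            * apply (is_derive_plus (fun _ => 1) (fun t => Rpower t b)).
              -- apply (@is_derive_const R_AbsRing R_NormedModule).
              -- apply is_derive_Rpower; lra.
            * lra.
          + unfold G. replace (Rpower s (b - 1)) with (Rpower s b / s).
            * field; lra.
            * unfold Rminus. rewrite Rpower_plus, Rpower_Ropp, Rpower_1 by lra.
              reflexivity. }
      apply is_derive_unique in D1. apply is_derive_unique in D2.
      rewrite D1, Rminus_diag in D2. rewrite Ropp_0. symmetry; exact D2. }
  rewrite <- PSeries_alternating_opp.
  rewrite (PSeries_ext _ (fun k => (-1) ^ k * ((-1 + INR k * b) * rgamma (INR k * b + 0))))
    in H; [exact H|].
  intros [|k]; unfold a, PS_incr_1, zero; simpl.
  - replace (0 * b + 0) with 0 by ring. rewrite rgamma_0. ring.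
  - ring.
Qed.

(** * The solution, its primitives and their asymptotics *)

Lemma mittag_leffler_mlf (b z : R) : 0 < b -> mittag_leffler b z = mlf b 1 z.
Proof.
  intros Hb. apply series_sum_eq.
  apply is_series_ext with (fun k => rgamma (INR k * b + 1) * z ^ k).
  - intros k. rewrite Gamma_rgamma.
    + unfold Rdiv. rewrite Rinv_inv. apply Rmult_comm.
    + pose proof (index_ge0 b 0 k); lra.
  - apply Series_correct. apply ex_series_Rabs.
    apply CV_disk_inside. rewrite CV_radius_mlf; simpl; auto; lra.
Qed.

(** The factor [p + k b] is absorbed by the functional equation of [rgamma]. The case [p = 0], which
    gives [u'], relies on its validity at 0. *)
Lemma is_derive_mlf (b p r t : R) :
  0 < b -> 0 <= p -> 0 < t ->
  is_derive (fun t => Rpower t p * mlf b (p + 1) (r * Rpower t b)) t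
    (Rpower t (p - 1) * mlf b p (r * Rpower t b)).
Proof.
  intros Hb Hp Ht. unfold mlf.
  rewrite (PSeries_ext (fun k => rgamma (INR k * b + p))
             (fun k => (p + INR k * b) * rgamma (INR k * b + (p + 1)))).
  - apply is_derive_Rpower_PSeries; [exact Ht|].
    rewrite CV_radius_mlf; simpl; auto; lra.
  - intros k. rewrite <- Rplus_assoc, <- (rgamma_succ (INR k * b + p)).
    + ring.
    + apply index_ge0; lra.
Qed.

(** A squeeze from two uses of [mlf_shift]. The parameter 3 ensures [3 - 2 b >= b] for all [b < 1],
    as [mlf_ge0] requires; starting from 1 would require [b <= 1/3]. *)
Lemma is_lim_mlf_3 (b r : R) :
  0 < b < 1 -> r < 0 ->
  is_lim (fun t => Rpower t 2 * mlf b 3 (r * Rpower t b) * Rpower t (- (2 - b)))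
    p_infty (rgamma (3 - b) / - r).
Proof.
  intros Hb Hr.
  (* [K t^(-b)] bounds the error [E_{3-b}(r t^b) / (- r)]. *)
  set (K := rgamma (3 - 2 * b) / (r * r)).
  assert (Hlow : is_lim (fun t => rgamma (3 - b) / - r - K * Rpower t (- b)) p_infty
                   (rgamma (3 - b) / - r)).
  { replace (Finite (rgamma (3 - b) / - r)) with (Finite (rgamma (3 - b) / - r - K * 0))
      by (f_equal; ring).
    apply is_lim_minus'; [apply is_lim_const|].
    apply (is_lim_scal_l _ K p_infty 0), is_lim_Rpower_neg; lra. }
  eapply is_lim_le_le_loc; [|exact Hlow|apply is_lim_const].
  exists 0. intros t Ht.
  pose proof (Rpower_gt0 t b) as Htb.
  assert (Hx : 0 < - r * Rpower t b) by nra.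
  assert (Ez : r * Rpower t b = - (- r * Rpower t b)) by ring.
  pose proof (mlf_ge0 b (3 - b) _ ltac:(lra) ltac:(lra) Hx) as P1.
  pose proof (mlf_ge0 b (3 - 2 * b) _ ltac:(lra) ltac:(lra) Hx) as P2.
  rewrite <- Ez in P1, P2.
  pose proof (mlf_shift b (3 - b) (r * Rpower t b) ltac:(lra) ltac:(lra)) as S1.
  pose proof (mlf_shift b (3 - 2 * b) (r * Rpower t b) ltac:(lra) ltac:(lra)) as S2.
  replace (3 - b + b) with 3 in S1 by ring.
  replace (3 - 2 * b + b) with (3 - b) in S2 by ring.
  assert (E : Rpower t 2 * mlf b 3 (r * Rpower t b) * Rpower t (- (2 - b))
              = (rgamma (3 - b) - mlf b (3 - b) (r * Rpower t b)) / - r).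
  { replace (rgamma (3 - b) - mlf b (3 - b) (r * Rpower t b))
      with (- (r * Rpower t b * mlf b 3 (r * Rpower t b))) by (rewrite S1; ring).
    replace (- (2 - b)) with (- (2) + b) by ring. rewrite Rpower_plus, Rpower_Ropp.
    pose proof (Rpower_gt0 t 2). field; lra. }
  rewrite E. unfold Rdiv. rewrite Rmult_minus_distr_r.
  assert (Hri : 0 < / - r) by (apply Rinv_0_lt_compat; lra).
  split; [|nra].
  apply Rplus_le_compat_l, Ropp_le_contravar.
  unfold K. rewrite Rpower_Ropp.
  apply (Rmult_le_reg_r (r * r * Rpower t b)).
  { apply Rmult_lt_0_compat; nra. }
  replace (mlf b (3 - b) (r * Rpower t b) * / - r * (r * r * Rpower t b))
    with (- (r * Rpower t b * mlf b (3 - b) (r * Rpower t b))) by (field; lra).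
  replace (rgamma (3 - 2 * b) / (r * r) * / Rpower t b * (r * r * Rpower t b))
    with (rgamma (3 - 2 * b)) by (field; lra).
  rewrite S2. lra.
Qed.

Theorem theorem4 (beta r : R) (hb0 : 0 < beta) (hb1 : beta < 1) (hr : r < 0) :
  let u := fun t : R => mittag_leffler beta (r * Rpower t beta) in
  exists u' : R -> R,
    (forall t : R, 0 < t -> derivable_pt_lim u t (u' t)) /\
    (forall eps : R, 0 < eps -> exists M : R, forall t : R, M < t ->
        Rabs (- (t * u' t / u t)  - beta) < eps).
Proof.
  intros u.
  set (z := fun t => r * Rpower t beta).
  (* A chain of derivatives [w2 -> w1 -> w0 -> u'], with [w0 = u]; the powers [t^1] and [t^0] are
     kept to match [is_derive_mlf]. *)
  set (w2 := fun t => Rpower t 2 * mlf beta 3 (z t)).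
  set (w1 := fun t => Rpower t 1 * mlf beta 2 (z t)).
  set (w0 := fun t => Rpower t 0 * mlf beta 1 (z t)).
  set (u' := fun t => Rpower t (-1) * mlf beta 0 (z t)).
  assert (Hz : forall t, z t = - (- r * Rpower t beta)) by (intros t; unfold z; ring).
  assert (Hx : forall t, 0 < - r * Rpower t beta).
  { intros t. apply Rmult_lt_0_compat; [lra|apply Rpower_gt0]. }
  assert (Hu : forall t, w0 t = u t).
  { intros t. unfold u, w0. rewrite mittag_leffler_mlf by exact hb0.
    unfold Rpower at 1. rewrite Rmult_0_l, exp_0. apply Rmult_1_l. }
  assert (D2 : forall t, 0 < t -> is_derive w2 t (w1 t)).
  { intros t Ht. pose proof (is_derive_mlf beta 2 r t hb0 ltac:(lra) Ht) as D.
    replace (2 + 1) with 3 in D by ring. replace (2 - 1) with 1 in D by ring. exact D. }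
  assert (D1 : forall t, 0 < t -> is_derive w1 t (w0 t)).
  { intros t Ht. pose proof (is_derive_mlf beta 1 r t hb0 ltac:(lra) Ht) as D.
    replace (1 + 1) with 2 in D by ring. replace (1 - 1) with 0 in D by ring. exact D. }
  assert (D0 : forall t, 0 < t -> is_derive w0 t (u' t)).
  { intros t Ht. pose proof (is_derive_mlf beta 0 r t hb0 ltac:(lra) Ht) as D.
    replace (0 + 1) with 1 in D by ring.
    replace (0 - 1) with (-1) in D by ring. exact D. }
  assert (M1 : forall s t, 0 < s <= t -> w1 s <= w1 t).
  { apply derive_ge0_incr with w0; [exact D1|]. intros t Ht. unfold w0.
    apply Rmult_le_pos; [apply Rlt_le, Rpower_gt0|].
    rewrite Hz. apply mlf_ge0; auto; lra. }
  assert (M0 : forall s t, 0 < s <= t -> w0 t <= w0 s).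
  { intros s t Hst. apply Ropp_le_cancel. revert s t Hst.
    apply derive_ge0_incr with (fun t => - u' t).
    - intros t Ht. apply (is_derive_opp w0), D0, Ht.
    - intros t Ht. unfold u'. rewrite Hz.
      pose proof (mlf_0_le0 beta _ ltac:(lra) (Hx t)).
      pose proof (Rpower_gt0 t (-1)). nra. }
  assert (M' : forall s t, 0 < s <= t -> u' s <= u' t).
  (* For [u''] the factor [-1 + k b] stays explicit: absorbing it would need [rgamma] at [k b - 1],
     which is negative for [k = 0]. *)
  { apply derive_ge0_incr with (fun t => Rpower t (-1 - 1)
      * PSeries (fun k => (-1 + INR k * beta) * rgamma (INR k * beta + 0)) (z t)).
    - intros t Ht. apply is_derive_Rpower_PSeries; [exact Ht|].
      rewrite CV_radius_mlf; simpl; auto; lra.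
    - intros t Ht. apply Rmult_le_pos; [apply Rlt_le, Rpower_gt0|].
      rewrite Hz. apply mlf_second_derivative_ge0; auto; lra. }
  set (A := rgamma (3 - beta) / - r).
  assert (HA : 0 < A).
  { apply Rdiv_lt_0_compat; [apply rgamma_gt0; lra|lra]. }
  pose proof (is_lim_mlf_3 beta r (conj hb0 hb1) hr) as L2. fold A in L2.
  (* The exponents descend through [2 - beta], [1 - beta], [- beta] and [- beta - 1]; each step
     multiplies the limit by the exponent it leaves, giving [B] for [u] and [- beta B] for [u']. *)
  assert (L1 := monotone_density_incr w2 w1 _ _ D2 M1 L2).
  replace (1 - (2 - beta)) with (- (1 - beta)) in L1 by ring.
  assert (L0 := monotone_density_decr w1 w0 _ _ D1 M0 L1).
  replace (1 - (1 - beta)) with (- - beta) in L0 by ring.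
  assert (L' := monotone_density_incr w0 u' _ _ D0 M' L0).
  set (B := (1 - beta) * ((2 - beta) * A)) in *.
  assert (HB : 0 < B).
  { apply Rmult_lt_0_compat; [lra|]. apply Rmult_lt_0_compat; lra. }
  exists u'. split.
  - intros t Ht. apply is_derive_Reals, is_derive_ext with w0; auto.
  - assert (Lq : is_lim (fun t => - (t * u' t / u t)) p_infty beta).
    (* Multiplying numerator and denominator by [t^beta] gives two functions with finite limits, the
       lower one [B], which is nonzero. *)
    { apply is_lim_ext_loc with (fun t => - (u' t * Rpower t (1 - - beta)
                                     / (w0 t * Rpower t (- - beta)))).
      - exists 0. intros t Ht. rewrite <- Hu. f_equal.
        replace (1 - - beta) with (1 + - - beta) by ring.
        rewrite Rpower_plus, Rpower_1 by exact Ht.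
        pose proof (Rpower_gt0 t (- - beta)).
        unfold Rdiv. rewrite Rinv_mult.
        replace (u' t * (t * Rpower t (- - beta)) * (/ w0 t * / Rpower t (- - beta)))
          with (t * u' t * / w0 t * (Rpower t (- - beta) * / Rpower t (- - beta))) by ring.
        rewrite Rinv_r by lra. ring.
      - replace (Finite beta) with (Rbar_opp (Rbar_div (- beta * B) B))
          by (simpl; f_equal; field; lra).
        apply is_lim_opp, is_lim_div; [exact L'|exact L0| |exact I].
        intros E; injection E; lra. }
    apply is_lim_spec in Lq. intros eps Heps.
    exact (Lq (mkposreal eps Heps)).
Qed.
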